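(* (Strong Normalization.) Let beta-reduction on proof terms be the congruence closure of $(\lambda a.p)\ p'\to_\beta[p'/a]p$. If $e:F$ is derivable (given some logic program $\Phi$), then $e$ is strongly normalizing with respect to beta-reduction.
   Context: First-order terms $t ::= x \mid f(t_1,\dots,t_n)$; atomic formulas $P(t_1,\dots,t_n)$; Horn formulas $F ::= [\forall \underline{x}].\ A_1,\dots,A_n \Rightarrow A$ ($n\ge0$), where $\forall\underline{x}.F$ quantifies all free term variables of $F$ and $[\forall\underline{x}].F$ means $F$ or $\forall\underline{x}.F$. Proof terms $p,e ::= \kappa \mid a \mid \lambda a.e \mid e\ e'$ ($\kappa$ proof-term constants, $a$ proof-term variables). A logic program $\Phi$ is a list of closed Horn formulas labelled by distinct proof-term constants $\kappa$. Typing $e:F$ given $\Phi$ is generated by: (axiom) $\kappa:\forall\underline{x}.F$ if $(\kappa:\forall\underline{x}.F)\in\Phi$; (gen) from $e:F$ infer $e:\forall\underline{x}.F$; (inst) from $e:\forall\underline{x}.F$ infer $e:[\underline{t}/\underline{x}]F$; (cut) from $e_1:\underline{A}\Rightarrow D$ and $e_2:\underline{B},D\Rightarrow C$ infer $\lambda\underline{a}.\lambda\underline{b}.(e_2\ \underline{b})\ (e_1\ \underline{a}) : \underline{A},\underline{B}\Rightarrow C$, where $\underline{a},\underline{b}$ are lists of proof-term variables of the lengths of $\underline{A},\underline{B}$ not free in $e_1,e_2$, $\lambda\underline{a}.t=\lambda a_1.\cdots\lambda a_n.t$ and $t\ \underline{b}=(\dots(t\ b_1)\dots b_n)$. *)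

(* Defs.v *)
From Stdlib Require Import List Arith.
From Stdlib Require Vector.
Import ListNotations.

Set Implicit Arguments.
Unset Strict Implicit.

Record signature : Type := Signature {
  fsym : Type;
  psym : Type;
  farity : fsym -> nat;
  parity : psym -> nat
}.

Section FirstOrder.
Context {S : signature}.

Inductive term : Type :=
| TVar : nat -> term
| TFun : forall f : fsym S, Vector.t term (farity f) -> term.

Record atom : Type := Atom {
  apred : psym S;
  aargs : Vector.t term (parity apred)
}.

(* [Clause As A] is the quantifier-free formula As => A. *)
Record clause : Type := Clause {
  body : list atom;
  head : atom
}.

(* The quantifier binds all the term variables of the clause, so it carries
   no list of variables, and a quantified formula has no free ones. *)
Inductive horn : Type :=
| Open : clause -> horn
| Forall : clause -> horn.

Inductive tfree (x : nat) : term -> Prop :=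
| tfree_var : tfree x (TVar x)
| tfree_fun : forall (f : fsym S) (ts : Vector.t term (farity f)) (t : term),
    Vector.In t ts -> tfree x t -> tfree x (TFun ts).

Definition afree (x : nat) (A : atom) : Prop :=
  exists t : term, Vector.In t (aargs A) /\ tfree x t.

Definition cfree (x : nat) (c : clause) : Prop :=
  (exists A : atom, In A (body c) /\ afree x A) \/ afree x (head c).

Definition hfree (x : nat) (F : horn) : Prop :=
  match F with
  | Open c => cfree x c
  | Forall _ => False
  end.

Definition closed (F : horn) : Prop := forall x : nat, ~ hfree x F.

Fixpoint tsubst (s : nat -> term) (t : term) : term :=
  match t with
  | TVar x => s x
  | TFun ts => TFun (Vector.map (tsubst s) ts)
  end.

Definition asubst (s : nat -> term) (A : atom) : atom :=
  Atom (Vector.map (tsubst s) (aargs A)).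

Definition csubst (s : nat -> term) (c : clause) : clause :=
  Clause (map (asubst s) (body c)) (asubst s (head c)).

End FirstOrder.

Arguments term S : clear implicits.
Arguments atom S : clear implicits.
Arguments clause S : clear implicits.
Arguments horn S : clear implicits.

Section ProofTerms.
Context {K : Type}.

(* Proof terms up to renaming of bound variables, with de Bruijn indices. *)
Inductive pterm : Type :=
| PConst : K -> pterm
| PVar : nat -> pterm
| PLam : pterm -> pterm
| PApp : pterm -> pterm -> pterm.

Definition upren (r : nat -> nat) (i : nat) : nat :=
  match i with
  | 0 => 0
  | S j => S (r j)
  end.

Fixpoint pren (r : nat -> nat) (p : pterm) : pterm :=
  match p with
  | PConst k => PConst k
  | PVar i => PVar (r i)
  | PLam q => PLam (pren (upren r) q)
  | PApp q q' => PApp (pren r q) (pren r q')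
  end.

Definition plift (n : nat) : pterm -> pterm := pren (Nat.add n).

Definition upsub (s : nat -> pterm) (i : nat) : pterm :=
  match i with
  | 0 => PVar 0
  | S j => plift 1 (s j)
  end.

Fixpoint psubst (s : nat -> pterm) (p : pterm) : pterm :=
  match p with
  | PConst k => PConst k
  | PVar i => s i
  | PLam q => PLam (psubst (upsub s) q)
  | PApp q q' => PApp (psubst s q) (psubst s q')
  end.

(* [psubst1 p' p] is [p'/a]p for the variable [a] of index 0 in [p]; the
   binder of [a] disappears, hence the remaining indices decrease. *)
Definition psubst1 (p' p : pterm) : pterm :=
  psubst (fun i => match i with 0 => p' | S j => PVar j end) p.

Inductive beta : pterm -> pterm -> Prop :=
| beta_redex : forall p p', beta (PApp (PLam p) p') (psubst1 p' p)
| beta_lam : forall p q, beta p q -> beta (PLam p) (PLam q)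
| beta_appl : forall p q r, beta p q -> beta (PApp p r) (PApp q r)
| beta_appr : forall p q r, beta p q -> beta (PApp r p) (PApp r q).

Definition strongly_normalizing (p : pterm) : Prop :=
  Acc (fun q' q => beta q q') p.

Definition lams (n : nat) (p : pterm) : pterm := Nat.iter n PLam p.

Definition apps (p : pterm) (qs : list pterm) : pterm := fold_left PApp qs p.

(* The variables bound by [n] consecutive abstractions, outermost first, seen
   from below [d] further abstractions: d+n-1, ..., d. *)
Definition bvars (d n : nat) : list pterm := map PVar (rev (seq d n)).

(* \a_1...a_n. \b_1...b_m. (e2 b_1 ... b_m) (e1 a_1 ... a_n); lifting [e1] and
   [e2] expresses that no a_i or b_j is free in them. *)
Definition cut_term (n m : nat) (e1 e2 : pterm) : pterm :=
  lams n (lams m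
    (PApp (apps (plift (n + m) e2) (bvars 0 m))
          (apps (plift (n + m) e1) (bvars m n)))).

End ProofTerms.

Arguments pterm K : clear implicits.

Definition logic_program (S : signature) (K : Type)
    (Phi : list (K * horn S)) : Prop :=
  NoDup (map fst Phi) /\ forall k F, In (k, F) Phi -> closed F.

Inductive typing (S : signature) (K : Type) (Phi : list (K * horn S)) :
    pterm K -> horn S -> Prop :=
| ty_axiom : forall k F, In (k, F) Phi -> typing Phi (PConst k) F
| ty_gen : forall e c, typing Phi e (Open c) -> typing Phi e (Forall c)
| ty_inst : forall e c (s : nat -> term S),
    typing Phi e (Forall c) -> typing Phi e (Open (csubst s c))
| ty_cut : forall e1 e2 As Bs D C,
    typing Phi e1 (Open (Clause As D)) ->
    typing Phi e2 (Open (Clause (Bs ++ [D]) C)) ->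
    typing Phi (cut_term (length As) (length Bs) e1 e2)
      (Open (Clause (As ++ Bs) C)).

(* Main.v *)
Require Import Defs.
From Stdlib Require Import List.
From Stdlib Require Import Arith Lia Relations.
Import ListNotations.

(** Forget the first-order layer: the body length n of the clause proved by [e]
    is the number of arguments that [e] expects. By induction on the typing
    derivation, [e] applied to any n strongly normalizing terms is strongly
    normalizing. No reducibility at higher types is needed, because the
    variables bound in a cut never occur in head position: after instantiation
    by us1, us2 the body of the cut is [e2 us2 (e1 us1)], where [e1 us1] is just
    one more strongly normalizing argument of [e2]. *)

(** * Substitution calculus for de Bruijn proof terms *)

Section Substitution.
Context {K : Type}.
Implicit Types (p q u : pterm K) (s t : nat -> pterm K) (us : list (pterm K)).

(** Here and in the next lemmas a pointwise equation gives the composite, so the induction passes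
    under binders without function extensionality. *)
Lemma pren_pren (r r' r'' : nat -> nat) p :
  (forall i, r (r' i) = r'' i) -> pren r (pren r' p) = pren r'' p.
Proof.
  revert r r' r''; induction p as [k|i|p IH|p IHp q IHq]; intros r r' r'' H; simpl;
    [auto|auto| |f_equal; eauto].
  f_equal; apply IH; intros [|i]; simpl; auto.
Qed.

Lemma pren_psubst (r : nat -> nat) s t p :
  (forall i, pren r (s i) = t i) -> pren r (psubst s p) = psubst t p.
Proof.
  revert r s t; induction p as [k|i|p IH|p IHp q IHq]; intros r s t H; simpl;
    [auto|auto| |f_equal; eauto].
  f_equal; apply IH; intros [|i]; simpl; auto.
  rewrite <- H. unfold plift.
  rewrite (pren_pren _ _ (fun j => S (r j))) by reflexivity.
  rewrite (pren_pren _ _ (fun j => S (r j))) by reflexivity.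
  reflexivity.
Qed.

Lemma psubst_pren (r : nat -> nat) s t p :
  (forall i, s (r i) = t i) -> psubst s (pren r p) = psubst t p.
Proof.
  revert r s t; induction p as [k|i|p IH|p IHp q IHq]; intros r s t H; simpl;
    [auto|auto| |f_equal; eauto].
  f_equal; apply IH; intros [|i]; simpl; auto.
  now rewrite H.
Qed.

Lemma psubst_psubst s s' t p :
  (forall i, psubst s (s' i) = t i) -> psubst s (psubst s' p) = psubst t p.
Proof.
  revert s s' t; induction p as [k|i|p IH|p IHp q IHq]; intros s s' t H; simpl;
    [auto|auto| |f_equal; eauto].
  f_equal; apply IH; intros [|i]; simpl; auto.
  rewrite <- H. unfold plift.
  rewrite (psubst_pren _ _ (fun j => plift 1 (s j))) by reflexivity.
  symmetry; now apply pren_psubst.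
Qed.

Lemma psubst_id s p : (forall i, s i = PVar i) -> psubst s p = p.
Proof.
  revert s; induction p as [k|i|p IH|p IHp q IHq]; intros s H; simpl;
    [auto|auto| |f_equal; eauto].
  f_equal; apply IH; intros [|i]; simpl; auto.
  now rewrite H.
Qed.

Lemma pren_psubst_var (r : nat -> nat) p :
  pren r p = psubst (fun i => PVar (r i)) p.
Proof.
  rewrite <- (psubst_id PVar (pren r p)) by reflexivity.
  now apply psubst_pren.
Qed.

Definition scons u s (i : nat) : pterm K :=
  match i with
  | 0 => u
  | S j => s j
  end.

Lemma psubst1_psubst_upsub u s p :
  psubst1 u (psubst (upsub s) p) = psubst (scons u s) p.
Proof.
  unfold psubst1; apply psubst_psubst; intros [|i]; simpl; auto.
  unfold plift; rewrite (psubst_pren _ _ PVar) by reflexivity.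
  now apply psubst_id.
Qed.

Lemma psubst_psubst1 s u p :
  psubst s (psubst1 u p) = psubst1 (psubst s u) (psubst (upsub s) p).
Proof.
  rewrite psubst1_psubst_upsub; unfold psubst1.
  now apply psubst_psubst; intros [|i].
Qed.

(** * Argument spines and their simultaneous instantiation *)

Lemma psubst_apps s p us :
  psubst s (apps p us) = apps (psubst s p) (map (psubst s) us).
Proof. revert p; induction us; intros p; simpl; auto. Qed.

Lemma apps_rcons p us u : apps p (us ++ [u]) = PApp (apps p us) u.
Proof. unfold apps; now rewrite fold_left_app. Qed.

(* The last element of [us] replaces the variable 0, as it is the argument of
   the innermost abstraction. *)
Definition instvars us s : nat -> pterm K := fold_left (fun s u => scons u s) us s.

Lemma instvars_app us vs s : instvars (us ++ vs) s = instvars vs (instvars us s).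
Proof. apply fold_left_app. Qed.

Lemma instvars_ge us s i : instvars us s (length us + i) = s i.
Proof.
  revert i; induction us as [|u us IH] using rev_ind; intros i; [reflexivity|].
  rewrite instvars_app, length_app, Nat.add_1_r; apply IH.
Qed.

Lemma instvars_bvars us s : map (psubst (instvars us s)) (bvars 0 (length us)) = us.
Proof.
  unfold bvars; rewrite map_map; simpl.
  induction us as [|u us IH] using rev_ind; [reflexivity|].
  rewrite instvars_app, length_app, Nat.add_1_r; simpl.
  rewrite <- seq_shift, map_app, <- map_rev, map_map; simpl.
  now f_equal.
Qed.

(** Written as a substitution, the shift composes with [instvars], where [instvars_ge] skips the d
    innermost variables. *)
Lemma bvars_add d n : bvars d n = map (psubst (fun i => PVar (d + i))) (@bvars K 0 n).
Proof.
  unfold bvars; rewrite map_map; simpl.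
  replace (seq d n) with (map (Nat.add d) (seq 0 n)).
  - now rewrite <- map_rev, map_map.
  - revert d; induction n; intros d; simpl; auto.
    rewrite Nat.add_0_r, <- (IHn (S d)), <- seq_shift, map_map.
    f_equal; apply map_ext; intros; lia.
Qed.

End Substitution.

(** * Compatibility of beta-reduction with substitution and application *)

Section Normalization.
Context {K : Type}.
Implicit Types (p q u : pterm K) (s t : nat -> pterm K) (us : list (pterm K)).

Lemma beta_psubst s p q : beta p q -> beta (psubst s p) (psubst s q).
Proof.
  intros H; revert s; induction H; intros s; simpl; try (constructor; auto).
  rewrite psubst_psubst1; constructor.
Qed.

Definition betas : pterm K -> pterm K -> Prop := clos_refl_trans _ (@beta K).

Lemma betas_map (f : pterm K -> pterm K) p q :
  (forall p q, beta p q -> beta (f p) (f q)) -> betas p q -> betas (f p) (f q).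
Proof.
  intros Hf H; induction H; [apply rt_step; auto | apply rt_refl | eapply rt_trans; eauto].
Qed.

(** Several steps may be needed, since [s i] is copied once per occurrence of the variable i. *)
Lemma betas_psubst s t p : (forall i, betas (s i) (t i)) -> betas (psubst s p) (psubst t p).
Proof.
  revert s t; induction p as [k|i|p IH|p IHp q IHq]; intros s t H; simpl.
  - apply rt_refl.
  - apply H.
  - apply (betas_map PLam); [now constructor|].
    apply IH; intros [|i]; simpl; [apply rt_refl|].
    unfold plift; rewrite !pren_psubst_var.
    apply (betas_map (psubst _)); auto using beta_psubst.
  - apply rt_trans with (PApp (psubst t p) (psubst s q)).
    + apply (betas_map (fun p => PApp p (psubst s q))); [now constructor|auto].
    + apply (betas_map (PApp (psubst t p))); [now constructor|auto].
Qed.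

Lemma beta_apps p q us : beta p q -> beta (apps p us) (apps q us).
Proof.
  revert p q; induction us; intros p q H; simpl; auto.
  apply IHus; now constructor.
Qed.

Lemma betas_psubst1_arg u u' p us :
  beta u u' -> betas (apps (psubst1 u p) us) (apps (psubst1 u' p) us).
Proof.
  intros H; apply (betas_map (fun p => apps p us)); [intros; now apply beta_apps|].
  apply betas_psubst; intros [|i]; [now apply rt_step | apply rt_refl].
Qed.

(** * Closure properties of strong normalization *)

Lemma sn_betas p q : betas p q -> strongly_normalizing p -> strongly_normalizing q.
Proof. induction 1; auto. intros [Hx]; now apply Hx. Qed.

Lemma sn_apps_head p us : strongly_normalizing (apps p us) -> strongly_normalizing p.
Proof.
  intros H; remember (apps p us) as a eqn:E; revert p E.
  induction H as [a _ IH]; intros p ->.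
  constructor; intros q Hq; eapply IH; [|reflexivity]; now apply beta_apps.
Qed.

(** The last case records a step inside [us] by its effect under every head, so that it can be
    replayed on the contractum. *)
Lemma beta_apps_redex_inv p u us r :
  beta (apps (PApp (PLam p) u) us) r ->
  r = apps (psubst1 u p) us
  \/ (exists p', beta p p' /\ r = apps (PApp (PLam p') u) us)
  \/ (exists u', beta u u' /\ r = apps (PApp (PLam p) u') us)
  \/ (exists us', r = apps (PApp (PLam p) u) us' /\
        forall q, beta (apps q us) (apps q us')).
Proof.
  revert r; induction us as [|v us IH] using rev_ind; intros r H.
  - simpl in H; inversion H as [| |? q' ? Hq|]; subst; simpl; eauto 6.
    inversion Hq; subst; eauto 6.
  - rewrite apps_rcons in H; inversion H as [p0 p1 E| |p0 q0 r0 Hq|p0 q0 r0 Hq]; subst.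
    (* A redex at the root would make an application equal to an abstraction. *)
    + destruct us as [|w us _] using rev_ind; [discriminate|].
      now rewrite apps_rcons in E.
    + destruct (IH _ Hq) as [->|[(p' & ? & ->)|[(u' & ? & ->)|(us' & -> & Hus)]]].
      * left; now rewrite apps_rcons.
      * right; left; exists p'; now rewrite apps_rcons.
      * right; right; left; exists u'; now rewrite apps_rcons.
      * right; right; right; exists (us' ++ [v]); split; [now rewrite apps_rcons|].
        intros q; rewrite !apps_rcons; now constructor.
    + right; right; right; exists (us ++ [q0]); split; [now rewrite apps_rcons|].
      intros q; rewrite !apps_rcons; now constructor.
Qed.

(** A step in [p] or [us] is matched by a step of the contractum. A step in [u] may leave the
    contractum unchanged, when the variable does not occur, hence the outer induction on [u]. *)
Lemma sn_head_expansion p u us :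
  strongly_normalizing u -> strongly_normalizing (apps (psubst1 u p) us) ->
  strongly_normalizing (apps (PApp (PLam p) u) us).
Proof.
  intros Hu; revert p us; induction Hu as [u Hu IHu]; intros p us Ht.
  remember (apps (psubst1 u p) us) as a eqn:E; revert p us E.
  induction Ht as [a Ha IHa]; intros p us ->.
  constructor; intros r Hr.
  destruct (beta_apps_redex_inv _ _ _ _ Hr)
    as [->|[(p' & Hp & ->)|[(u' & Hu' & ->)|(us' & -> & Hus)]]].
  - constructor; exact Ha.
  - apply (IHa (apps (psubst1 u p') us)); [|reflexivity].
    now apply beta_apps, beta_psubst.
  - apply IHu; [assumption|].
    apply (sn_betas _ _ (betas_psubst1_arg _ _ _ _ Hu')); constructor; exact Ha.
  - eapply IHa; [|reflexivity]; apply Hus.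
Qed.

(** Each head expansion removes one abstraction and records its argument in the substitution, until
    only the instantiated body remains. *)
Lemma sn_apps_lams s p us :
  Forall (@strongly_normalizing K) us ->
  strongly_normalizing (psubst (instvars us s) p) ->
  strongly_normalizing (apps (psubst s (lams (length us) p)) us).
Proof.
  intros Hus; revert s; induction Hus as [|u us Hu _ IH]; intros s H; [exact H|].
  simpl; apply sn_head_expansion; [assumption|].
  rewrite psubst1_psubst_upsub; now apply IH.
Qed.

Lemma beta_apps_const_inv (k : K) us r :
  beta (apps (PConst k) us) r -> exists us', r = apps (PConst k) us'.
Proof.
  revert r; induction us as [|v us IH] using rev_ind; intros r H; [inversion H|].
  rewrite apps_rcons in H; inversion H as [p0 p1 E| |p0 q0 r0 Hq|p0 q0 r0 Hq]; subst.
  - destruct us as [|w us _] using rev_ind; [discriminate|].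
    now rewrite apps_rcons in E.
  - destruct (IH _ Hq) as [us' ->]; exists (us' ++ [v]); now rewrite apps_rcons.
  - exists (us ++ [q0]); now rewrite apps_rcons.
Qed.

(** A spine headed by a constant never becomes an abstraction, so reduction stays inside the
    arguments. The inner induction is lexicographic: first the prefix, then the last argument. *)
Lemma sn_apps_const (k : K) us :
  Forall (@strongly_normalizing K) us -> strongly_normalizing (apps (PConst k) us).
Proof.
  induction us as [|u us IH] using rev_ind; intros H.
  - constructor; intros r Hr; inversion Hr.
  - apply Forall_app in H as [Hus Hu]; inversion_clear Hu as [|? ? Hu' _].
    rewrite apps_rcons.
    specialize (IH Hus); clear Hus.
    remember (apps (PConst k) us) as a eqn:E; revert us E u Hu'.
    induction IH as [a Ha IHa]; intros us -> u Hu.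
    induction Hu as [u Hu IHu].
    constructor; intros r Hr.
    inversion Hr as [p0 p1 E| |p0 q0 r0 Hq|p0 q0 r0 Hq]; subst.
    + destruct us as [|w us _] using rev_ind; [discriminate|].
      now rewrite apps_rcons in E.
    + destruct (beta_apps_const_inv _ _ _ Hq) as [us' ->].
      eapply IHa; [exact Hq|reflexivity|constructor; exact Hu].
    + now apply IHu.
Qed.

(** * Normalization at a given arity *)

Definition sn_at_arity (n : nat) (e : pterm K) : Prop :=
  forall us, length us = n -> Forall (@strongly_normalizing K) us ->
    strongly_normalizing (apps e us).

Lemma psubst_instvars_plift us e :
  psubst (instvars us PVar) (plift (length us) e) = e.
Proof.
  unfold plift; rewrite (psubst_pren _ _ PVar).
  - now apply psubst_id.
  - intros i; apply instvars_ge.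
Qed.

Lemma sn_cut_term (n m : nat) (e1 e2 : pterm K) :
  sn_at_arity n e1 -> sn_at_arity (S m) e2 ->
  sn_at_arity (n + m) (cut_term n m e1 e2).
Proof.
  intros H1 H2 us Hlen Hus; unfold cut_term.
  (* The first n arguments instantiate the a_i, the other m the b_j. *)
  rewrite <- (firstn_skipn n us) in Hus |- *.
  assert (Hn : length (firstn n us) = n) by (rewrite length_firstn; lia).
  assert (Hm : length (skipn n us) = m) by (rewrite length_skipn; lia).
  revert Hus Hn Hm; generalize (firstn n us), (skipn n us); clear us Hlen.
  intros us1 us2 Hus Hn Hm.
  assert (Hlen : n + m = length (us1 ++ us2)) by (rewrite length_app; lia).
  unfold lams; rewrite <- Nat.iter_add, Hlen.
  rewrite <- (psubst_id PVar (Nat.iter _ _ _)) by reflexivity.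
  apply sn_apps_lams; [assumption|]; simpl.
  rewrite !psubst_apps, !psubst_instvars_plift.
  rewrite instvars_app.
  subst m; rewrite instvars_bvars.
  (* The a_i lie beyond the m variables b_j; undoing this shift leaves the instantiation by [us1]
     alone. *)
  rewrite bvars_add, map_map.
  rewrite (map_ext _ (psubst (instvars us1 PVar))).
  2:{ intros p; apply psubst_psubst; intros i; apply instvars_ge. }
  subst n; rewrite instvars_bvars.
  apply Forall_app in Hus as [Hus1 Hus2].
  (* The term is [e2] applied to [us2] followed by [e1 us1], which makes m + 1 arguments. *)
  rewrite <- apps_rcons; apply H2.
  - rewrite length_app; simpl; lia.
  - apply Forall_app; split; [assumption|].
    constructor; [now apply H1|constructor].
Qed.

Lemma sn_of_sn_at_arity (n : nat) (e : pterm K) :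
  sn_at_arity n e -> strongly_normalizing e.
Proof.
  (* Variables are normal, so n copies of one are admissible arguments, and the head of a
     normalizing spine is normalizing. *)
  intros H; apply (sn_apps_head e (repeat (PVar 0) n)), H; [apply repeat_length|].
  apply Forall_forall; intros p Hp; apply repeat_spec in Hp as ->.
  constructor; intros q Hq; inversion Hq.
Qed.

End Normalization.

(** * From typing derivations to arities *)

Definition arity (S : signature) (F : horn S) : nat :=
  match F with
  | Open c | Defs.Forall c => length (body c)
  end.

Lemma typing_sn_at_arity (S : signature) (K : Type) (Phi : list (K * horn S))
  (e : pterm K) (F : horn S) :
  typing Phi e F -> sn_at_arity (arity S F) e.
Proof.
  induction 1 as [k F _|e c _ IH|e c s _ IH|e1 e2 As Bs D C _ IH1 _ IH2].
  - intros us _; apply sn_apps_const.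
  - exact IH.
  - simpl; rewrite length_map; exact IH.
  (* The cut atom [D] is the last body atom of the clause of [e2], whose arity is therefore
     [S (length Bs)]. *)
  - simpl in *; rewrite length_app in *; simpl in IH2; rewrite Nat.add_1_r in IH2.
    now apply sn_cut_term.
Qed.

Theorem theorem2 (S : signature) (K : Type) (Phi : list (K * horn S))
  (e : pterm K) (F : horn S) :
  logic_program Phi -> typing Phi e F -> strongly_normalizing e.
Proof.
  intros _ H; exact (sn_of_sn_at_arity _ _ (typing_sn_at_arity _ _ _ _ _ H)).
Qed.
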